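(* Let $q\geq3$ and let $x,y$ be distinct non-adjacent vertices of the Farey graph $\mathcal{F}_q$. Every geodesic path in $\mathcal{F}_q$ from $x$ to $y$ is contained in the $q$-chain from $x$ to $y$ (all its vertices are vertices of that $q$-chain).
   Context: Let $\lambda_q=2\cos(\pi/q)$, $G_q$ the group generated by $\sigma(z)=-1/z$ and $\tau(z)=z+\lambda_q$, $\rho(z)=\lambda_q-1/z$. The Farey graph $\mathcal{F}_q$ has vertex set $G_q(\infty)\subset\mathbb{R}\cup\{\infty\}$, $u,v$ adjacent iff $\{u,v\}=\{g(0),g(\infty)\}$ for some $g\in G_q$; faces are the ideal hyperbolic $q$-gons $g(E)$, $g\in G_q$, with $E$ the ideal $q$-gon with vertices $\rho^i(\infty)$, $i=0,\dots,q-1$. For non-adjacent distinct vertices $x,y$, the $q$-chain from $x$ to $y$ is the subgraph formed by the vertices and edges of the faces whose interiors meet the hyperbolic geodesic joining $x$ and $y$. A geodesic path is a path (vertex sequence with consecutive vertices adjacent) of minimal length between its endpoints. *)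

(* Defs.v *)
From mathcomp Require Import all_boot all_order all_algebra complex.
From mathcomp Require Import all_classical all_reals all_analysis.

Set Implicit Arguments.
Unset Strict Implicit.
Unset Printing Implicit Defensive.

Import numFieldNormedType.Exports.
Import Order.TTheory GRing.Theory Num.Theory.

Local Open Scope classical_set_scope.
Local Open Scope ring_scope.
Local Open Scope complex_scope.

Local Notation Re := complex.Re.
Local Notation Im := complex.Im.

(* [option R[i]] is the extended complex plane, [None] being the point at
   infinity.  The boundary of the upper half-plane consists of [None] and of the
   [Some a] with [Im a = 0]. *)
Definition einf (R : realType) : option R[i] := None.
Definition ezero (R : realType) : option R[i] := Some 0.

Definition lambda (R : realType) (q : nat) : R := 2 * cos (pi / q%:R).

Definition sigma (R : realType) (z : option R[i]) : option R[i] :=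
  match z with
  | Some w => if w == 0 then None else Some (- w^-1)
  | None => Some 0
  end.

Definition tau (R : realType) (q : nat) (z : option R[i]) : option R[i] :=
  omap (fun w => w + (lambda R q)%:C) z.

Definition rho (R : realType) (q : nat) (z : option R[i]) : option R[i] :=
  tau q (sigma z).

Inductive generated (T : Type) (S : set (T -> T)) : (T -> T) -> Prop :=
| gen_in f of S f : generated S f
| gen_id : generated S id
| gen_comp f g of generated S f & generated S g : generated S (f \o g)
| gen_inv f g of generated S f & cancel f g & cancel g f : generated S g.

Definition Hecke (R : realType) (q : nat) : set (option R[i] -> option R[i]) :=
  generated [set f | f = @sigma R \/ f = tau q].

Definition farey_vertex (R : realType) (q : nat) : set (option R[i]) :=
  [set v | exists2 g, Hecke q g & v = g (einf R)].

Definition farey_adj (R : realType) (q : nat) (u v : option R[i]) : Prop :=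
  exists2 g, Hecke q g & [set u; v] = [set g (ezero R); g (einf R)].

(* For distinct boundary points [u], [v] and [z] in the closed upper half-plane
   (infinity included), [side u v z] is zero when [z] is on the hyperbolic line
   with ends [u], [v] or is one of its ends, and otherwise its sign tells on
   which side of that line [z] lies.  The line is a semicircle centred on the
   real axis, or a vertical half-line when one end is infinity. *)
Definition side (R : realType) (u v z : option R[i]) : R :=
  match u, v, z with
  | Some a, Some b, Some w =>
      (Re w - (Re a + Re b) / 2) ^+ 2 + Im w ^+ 2 - ((Re a - Re b) / 2) ^+ 2
  | Some _, Some _, None => 1
  | Some a, None, Some w | None, Some a, Some w => Re w - Re a
  | Some _, None, None | None, Some _, None => 0
  | None, None, _ => 1
  end.

Definition upper_half_plane (R : realType) : set R[i] := [set z | 0 < Im z].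

Definition hyp_line (R : realType) (u v : option R[i]) : set R[i] :=
  [set z | upper_half_plane z /\ side u v (Some z) = 0].

(* The closed ideal polygon whose vertices are the boundary points
   [v 0, ..., v (n-1)], listed in cyclic order: the region bounded by the
   hyperbolic lines joining consecutive vertices, that is, the points lying, for
   each such line, on the same closed side as the vertices of the polygon. *)
Definition ideal_polygon (R : realType) (n : nat) (v : 'I_n -> option R[i]) :
    set R[i] :=
  [set z | upper_half_plane z /\ forall i j : 'I_n,
     0 <= side (v i) (v (ordS i)) (Some z) * side (v i) (v (ordS i)) (v j)].

Definition E_vertex (R : realType) (q : nat) (i : 'I_q) : option R[i] :=
  iter i (rho q) (einf R).

Definition E (R : realType) (q : nat) : set R[i] :=
  ideal_polygon (@E_vertex R q).

Definition face (R : realType) (q : nat) (g : option R[i] -> option R[i]) :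
    set R[i] :=
  [set z | exists2 w, E q w & g (Some w) = Some z].

(* [R[i]^o] carries the norm topology of the complex plane. *)
Definition face_interior (R : realType) (q : nat)
    (g : option R[i] -> option R[i]) : set R[i] :=
  interior (face q g : set R[i]^o).

Record subgraph (T : Type) := Subgraph {
  sg_vertex : set T;
  sg_edge : T -> T -> Prop }.

Definition crossed (R : realType) (q : nat) (x y : option R[i])
    (g : option R[i] -> option R[i]) : Prop :=
  Hecke q g /\ face_interior q g `&` hyp_line x y !=set0.

Definition qchain (R : realType) (q : nat) (x y : option R[i]) :
    subgraph (option R[i]) :=
  {| sg_vertex := [set v | exists2 g, crossed q x y g &
       exists i : 'I_q, v = g (E_vertex R i)];
     sg_edge := fun u v => exists2 g, crossed q x y g &
       exists i : 'I_q,
         [set u; v] = [set g (E_vertex R i); g (E_vertex R (ordS i))] |}.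

(* The path with vertex sequence [x :: p], from [x] to [last x p]. *)
Definition farey_path (R : realType) (q : nat) (x : option R[i])
    (p : seq (option R[i])) : Prop :=
  path (fun u v => `[< farey_adj q u v >]) x p.

Definition geodesic_path (R : realType) (q : nat) (x y : option R[i])
    (p : seq (option R[i])) : Prop :=
  [/\ farey_path q x p, last x p = y
    & forall p', farey_path q x p' -> last x p' = y -> (size p <= size p')%N].

(* Main.v *)
(* A path from [x] to [y] that leaves the q-chain visits a vertex [v] cut off from
   [x] and [y] by a single edge [a b].  Edges do not cross, so the path meets
   [{a, b}] both before and after [v], and travelling along the edge instead is
   shorter.

   To find that edge, move [v] to infinity and let [c < d] be the images of [x]
   and [y].  The faces at infinity are the translates of [E], whose other vertices
   [rho^n(oo)], 0 < n < q, cut [[0, lambda]] into intervals spanned by edges.  If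
   [c] and [d] lie in one such interval (up to translation), its edge does the
   job.  Otherwise a vertex lies strictly between them, and the hyperbolic line
   from [c] to [d] meets the interior of a face at infinity.

   Edges do not cross because every element of the Hecke group is, up to [sigma]
   on either side, a product of maps [rho^n sigma] with 0 < n < q, whose matrices
   have nonnegative entries. *)
Require Import Defs.
From mathcomp Require Import all_boot all_order all_algebra complex.
From mathcomp Require Import all_classical all_reals all_analysis.
From mathcomp Require Import ring lra zify.

Set Implicit Arguments.
Unset Strict Implicit.
Unset Printing Implicit Defensive.

Import numFieldNormedType.Exports.
Import Order.TTheory GRing.Theory Num.Theory.

Local Open Scope classical_set_scope.
Local Open Scope ring_scope.
Local Open Scope complex_scope.

Local Notation Re := complex.Re.
Local Notation Im := complex.Im.

(** * Real Moebius maps in homogeneous coordinates *)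

Section Moebius.
Variable R : realType.
Implicit Types (p u v : option R[i]) (f g : option R[i] -> option R[i]).

(* [hom1 p : hom2 p] are homogeneous coordinates of [p]. *)
Definition hom1 p : R[i] := if p is Some w then w else 1.
Definition hom2 p : R[i] := if p is Some _ then 1 else 0.

(** The scalar [k] depends on [p]: it absorbs the normalisation of [hom1] and [hom2], so that poles
    and the point at infinity need no separate treatment. *)
Definition moebius f (a b c d : R) :=
  a * d - b * c = 1 /\
  forall p, exists2 k, k != 0 &
    hom1 (f p) = k * (a%:C * hom1 p + b%:C * hom2 p) /\
    hom2 (f p) = k * (c%:C * hom1 p + d%:C * hom2 p).

Lemma realCD (a b : R) : (a + b)%:C = a%:C + b%:C. Proof. exact: rmorphD. Qed.
Lemma realCB (a b : R) : (a - b)%:C = a%:C - b%:C. Proof. exact: rmorphB. Qed.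
Lemma realCM (a b : R) : (a * b)%:C = a%:C * b%:C. Proof. exact: rmorphM. Qed.
Lemma realCN (a : R) : (- a)%:C = - a%:C. Proof. exact: rmorphN. Qed.

Lemma moebius_comp f g a b c d a' b' c' d' :
  moebius f a b c d -> moebius g a' b' c' d' ->
  moebius (f \o g) (a * a' + b * c') (a * b' + b * d')
                   (c * a' + d * c') (c * b' + d * d').
Proof.
move=> [df Hf] [dg Hg]; split.
  transitivity ((a * d - b * c) * (a' * d' - b' * c')); first by ring.
  by rewrite df dg mulr1.
move=> p; have [k k0 [e1 e2]] := Hg p; have [l l0 [e3 e4]] := Hf (g p).
exists (l * k); first by rewrite mulf_neq0.
by rewrite /= e3 e4 e1 e2 !realCD !realCM; split; ring.
Qed.

Lemma moebius_inv f g a b c d : cancel g f ->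
  moebius f a b c d -> moebius g d (- b) (- c) a.
Proof.
move=> gK [df Hf]; split; first by rewrite -df; ring.
have dC : a%:C * d%:C - b%:C * c%:C = 1 :> R[i] by rewrite -!realCM -realCB df.
move=> p; have [k k0 [e1 e2]] := Hf (g p); rewrite gK in e1 e2.
exists k^-1; first by rewrite invr_neq0.
rewrite e1 e2 !realCN; split.
  transitivity (k^-1 * k * (a%:C * d%:C - b%:C * c%:C) * hom1 (g p)).
    by rewrite dC mulVf // !mul1r.
  by ring.
transitivity (k^-1 * k * (a%:C * d%:C - b%:C * c%:C) * hom2 (g p)).
  by rewrite dC mulVf // !mul1r.
by ring.
Qed.

Lemma moebius_sigma : moebius (@sigma R) 0 (- 1) 1 0.
Proof.
split; first by ring.
case=> [w|] /=.
  have [->|w0] /= := eqVneq w 0.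
    exists (-1); rewrite ?oppr_eq0 ?oner_eq0 // realCN.
    by split; ring.
  exists w^-1; rewrite ?invr_neq0 // realCN; split; first by ring.
  by rewrite mul0r addr0 mul1r mulVf.
exists 1; rewrite ?oner_eq0 //; split; ring.
Qed.

Lemma moebius_tau q : moebius (@tau R q) 1 (lambda R q) 0 1.
Proof.
split; first by ring.
case=> [w|] /=; exists 1; rewrite ?oner_eq0 //; split; ring.
Qed.

Lemma Hecke_moebius q f : Hecke q f -> exists a b c d, moebius f a b c d.
Proof.
elim=> {f} [f [->|->]| |f g _ [a [b [c [d Mf]]]] _ [a' [b' [c' [d' Mg]]]]
           |f g _ [a [b [c [d Mf]]]] fK gK].
- by do 4!eexists; exact: moebius_sigma.
- by do 4!eexists; exact: moebius_tau.
- exists 1, 0, 0, 1; split=> [|p]; first by ring.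
  by exists 1; rewrite ?oner_eq0 //; split; ring.
- by do 4!eexists; exact: moebius_comp Mf Mg.
- by do 4!eexists; exact: moebius_inv Mf.
Qed.

Lemma sigmaK : involutive (@sigma R).
Proof.
case=> [w|] /=; last by rewrite eqxx.
have [->|w0] //= := eqVneq w 0.
by rewrite oppr_eq0 invr_eq0 (negPf w0) invrN invrK opprK.
Qed.

Lemma Hecke_inv q f : Hecke q f ->
  exists2 g, Hecke q g & cancel f g /\ cancel g f.
Proof.
elim=> {f} [f [->|->]| |f1 f2 _ [g1 H1 [K1 K1']] _ [g2 H2 [K2 K2']]
           |f g Hf _ fK gK].
- exists (@sigma R); first by apply: gen_in; left.
  by split; exact: sigmaK.
- pose t := @omap R[i] R[i] (fun w => w - (lambda R q)%:C).
  have tK : cancel (@tau R q) t by case=> //= w; rewrite addrK.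
  have tK' : cancel t (@tau R q) by case=> //= w; rewrite subrK.
  by exists t => //; apply: gen_inv tK tK'; apply: gen_in; right.
- by exists id => //; exact: gen_id.
- exists (g2 \o g1); first exact: gen_comp.
  by split; exact: can_comp.
- by exists f.
Qed.

(** * The action on the boundary *)

Definition bd p := if p is Some w then Im w = 0 else True.
Definition rhom1 p := Re (hom1 p).
Definition rhom2 p := Re (hom2 p).

Lemma bd_hom1 p : bd p -> hom1 p = (rhom1 p)%:C.
Proof. by case: p => [[a b]|] //= ->. Qed.

Lemma bd_hom2 p : hom2 p = (rhom2 p)%:C.
Proof. by case: p. Qed.

(** The scalar is real because one homogeneous coordinate of [f p] equals 1, while the matrix sends
    real coordinates to real ones. *)
Lemma moebius_bd f a b c d p : moebius f a b c d -> bd p ->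
  bd (f p) /\ exists2 k : R, k != 0 &
    rhom1 (f p) = k * (a * rhom1 p + b * rhom2 p) /\
    rhom2 (f p) = k * (c * rhom1 p + d * rhom2 p).
Proof.
move=> [_ Hf] bp; have [k k0] := Hf p.
rewrite (bd_hom1 bp) bd_hom2 -!realCM -!realCD.
set A := _ + _; set B := _ + _ => -[e1 e2].
have [l kl] : exists l : R, k = l%:C.
  have inv (C : R) : 1 = k * C%:C -> k = C^-1%:C.
    move=> e; have C0 : C%:C != 0 by apply: contra_eq_neq e => ->;
      rewrite mulr0 oner_eq0.
    have C0' : C != 0 by apply: contraNneq C0 => ->.
    by apply: (mulIf C0); rewrite -e -realCM mulVf.
  by case: (f p) e1 e2 => [w|] /= e1 e2; [exists B^-1|exists A^-1]; exact: inv.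
move: k0 e1 e2; rewrite {}kl -!realCM => k0 e1 e2.
split; last first.
  exists l; first by apply: contraNneq k0 => ->.
  by rewrite /rhom1 /rhom2 e1 bd_hom2 in e2 *; case: e2.
by move: e1; case: (f p) => //= w ->.
Qed.

(** * Continuity, and the action on the upper half-plane and its hyperbolic lines *)

Lemma Re_continuous (z : R[i]^o) : @Re R x @[x --> z] --> (Re z : R).
Proof.
apply/(@cvgrPdist_lt _ R^o _ (nbhs z)) => e e0; apply/nbhs_ballP.
exists e%:C; first by rewrite /= ltcR.
move=> t; rewrite -ball_normE /= normc_def ltcR; apply: le_lt_trans.
rewrite -sqrtr_sqr; apply: ler_wsqrtr.
by case: z t => [? ?] [? ?] /=; rewrite lerDl sqr_ge0.
Qed.

Lemma Im_continuous (z : R[i]^o) : @Im R x @[x --> z] --> (Im z : R).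
Proof.
apply/(@cvgrPdist_lt _ R^o _ (nbhs z)) => e e0; apply/nbhs_ballP.
exists e%:C; first by rewrite /= ltcR.
move=> t; rewrite -ball_normE /= normc_def ltcR; apply: le_lt_trans.
rewrite -sqrtr_sqr; apply: ler_wsqrtr.
by case: z t => [? ?] [? ?] /=; rewrite lerDr sqr_ge0.
Qed.

Lemma homography_continuous (a b c d : R[i]) (z : R[i]^o) : c * z + d != 0 ->
  ((a * w + b) / (c * w + d) : R[i]^o) @[w --> z] -->
    ((a * z + b) / (c * z + d) : R[i]^o).
Proof.
have FF : ProperFilter (nbhs z) by exact: nbhs_pfilter.
move=> h; have aff (k l : R[i]) : (k * w + l : R[i]^o) @[w --> z] -->
  (k * z + l : R[i]^o).
  apply: (@cvgD _ R[i]^o _ _ FF); last exact: cvg_cst.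
  by apply: (@cvgM R[i] _ _ FF); [exact: cvg_cst|exact: cvg_id].
apply: (@cvgM R[i] _ _ FF); first exact: aff.
by apply: (@cvgV R[i] _ _ FF) => //; exact: aff.
Qed.

Lemma moebius_upper f a b c d z : moebius f a b c d -> 0 < Im z ->
  exists2 k, k != 0 &
    [/\ f (Some z) = Some (k * (a%:C * z + b%:C)), k * (c%:C * z + d%:C) = 1
      & 0 < Im (k * (a%:C * z + b%:C))].
Proof.
move=> [df Hf] z0; have [k k0] := Hf (Some z); rewrite /= !mulr1 => -[e1 e2].
have c0 : c%:C * z + d%:C != 0.
  apply/eqP; case: z z0 {e1 e2} => zr zi /= z0 [] h1 h2.
  have {}h2 : c * zi = 0 by lra.
  move/eqP: h2; rewrite mulf_eq0 (gt_eqF z0) orbF => /eqP c0.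
  have d0 : d = 0 by move: h1; rewrite c0; lra.
  by move: df; rewrite c0 d0; lra.
exists k => //; case: (f (Some z)) e1 e2 => [w|] /= e1 e2; last first.
  by move/esym/eqP: e2; rewrite mulf_eq0 (negPf k0) (negPf c0).
split; rewrite -?e1 //.
(* The factor inserted is the conjugate of 1; with it the imaginary part becomes
   [|k|^2 (ad - bc) Im z]. *)
have -> : Im w = Im (k * (a%:C * z + b%:C) * conjc (k * (c%:C * z + d%:C))).
  by rewrite -e2 -e1 conjc1 mulr1.
case: k z k0 z0 {e1 e2 c0 Hf w} => kr ki [zr zi] /= k0 z0.
rewrite [ltRHS](_ : _ = (kr ^+ 2 + ki ^+ 2) * ((a * d - b * c) * zi)); last by ring.
rewrite df mul1r mulr_gt0 // lt_neqAle addr_ge0 ?sqr_ge0 // andbT eq_sym.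
apply: contraNneq k0 => /eqP; rewrite paddr_eq0 ?sqr_ge0 // !sqrf_eq0.
by rewrite eq_complex.
Qed.

(* A quadratic form vanishing on the same line as [side u v], but on which real
   homographies act by scaling. *)
Definition line_form u v z : R :=
  Re ((hom2 u * z - hom1 u) * conjc (hom2 v * z - hom1 v)).

Lemma side_line_form u v z : bd u -> bd v -> u <> v ->
  (side u v (Some z) = 0) <-> (line_form u v z = 0).
Proof.
case: u v z => [[a a']|] [[b b']|] [x y] //= bu bv uv; rewrite /line_form /=;
  rewrite ?bu ?bv; split=> e; lra.
Qed.

(** Each of the two factors of [line_form] is multiplied by a real number and by the same complex
    [k], so the form itself is multiplied by a real number. *)
Lemma moebius_line f a b c d u v z w : moebius f a b c d ->
  bd u -> bd v -> f (Some z) = Some w ->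
  line_form u v z = 0 -> line_form (f u) (f v) w = 0.
Proof.
move=> Mf bu bv fz; have [df Hf] := Mf.
have dC : a%:C * d%:C - b%:C * c%:C = 1 :> R[i] by rewrite -!realCM -realCB df.
have [k k0] := Hf (Some z); rewrite fz /= !mulr1 => -[e1 e2].
have key p : bd p -> exists l : R,
    hom2 (f p) * w - hom1 (f p) = l%:C * (k * (hom2 p * z - hom1 p)).
  move=> bp; have [bp' [l l0 [h1 h2]]] := moebius_bd Mf bp; exists l.
  rewrite (bd_hom1 bp') bd_hom2 h1 h2 (bd_hom1 bp) bd_hom2.
  set X := rhom1 p; set Y := rhom2 p.
  rewrite !realCM !realCD !realCM e1 -[X in _ - X]mulr1 e2.
  transitivity (l%:C * (k * (a%:C * d%:C - b%:C * c%:C) * (Y%:C * z - X%:C))).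
    by ring.
  by rewrite dC mulr1.
have [l1 h1] := key u bu; have [l2 h2] := key v bv.
rewrite /line_form h1 h2; move: (_ - _) (_ - _) k {h1 h2 k0 e1 e2 key}.
move=> [x y] [x' y'] [k k'] /= h.
rewrite [LHS](_ : _ = l1 * l2 * (k ^+ 2 + k' ^+ 2) * (x' * x - y' * - y)); last by ring.
by rewrite h mulr0.
Qed.

Lemma moebius_eq f a b c d a' b' c' d' : moebius f a b c d ->
  a = a' -> b = b' -> c = c' -> d = d' -> moebius f a' b' c' d'.
Proof. by move=> Mf <- <- <- <-. Qed.

Lemma hom_inj p v k :
  hom1 v = k * hom1 p -> hom2 v = k * hom2 p -> v = p.
Proof.
case: p v => [w|] [z|] //=; rewrite ?mulr1 ?mulr0.
- by move=> -> <-; rewrite mul1r.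
- by move=> e1 e2; move: e1; rewrite -e2 mul0r => /eqP; rewrite oner_eq0.
- by move=> _ /eqP; rewrite oner_eq0.
Qed.

(** * Orientation of triples of boundary points *)

Definition hdet u v := rhom1 u * rhom2 v - rhom2 u * rhom1 v.

Lemma hdet_eq0 u v : bd u -> bd v -> hdet u v = 0 -> u = v.
Proof.
rewrite /hdet /rhom1 /rhom2.
case: u v => [[a a']|] [[b b']|] //= bu bv e; [|exfalso; lra|exfalso; lra].
by rewrite bu bv; congr (Some (_ +i* _)); lra.
Qed.

(** Each point enters two of the determinants, so rescaling its coordinates does not affect the
    sign. The sign is the cyclic orientation of the triple, positive for 0, 1, infinity. For fixed
    distinct [u] and [v] it tells on which side of their line the boundary point [w] lies. *)
Definition ccw u v w := hdet u v * hdet v w * hdet w u.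

Lemma ccw_moebius f a b c d : moebius f a b c d -> forall u v w,
  bd u -> bd v -> bd w -> exists2 l, 0 < l & ccw (f u) (f v) (f w) = l * ccw u v w.
Proof.
move=> Mf u v w bu bv bw.
have [_ [k1 k10 [e1 e1']]] := moebius_bd Mf bu.
have [_ [k2 k20 [e2 e2']]] := moebius_bd Mf bv.
have [_ [k3 k30 [e3 e3']]] := moebius_bd Mf bw.
exists ((k1 * k2 * k3) ^+ 2); first by rewrite exprn_even_gt0 //= !mulf_neq0.
have [df _] := Mf.
transitivity ((a * d - b * c) ^+ 3 * (k1 * k2 * k3) ^+ 2 * ccw u v w).
  by rewrite /ccw /hdet e1 e1' e2 e2' e3 e3'; ring.
by rewrite df expr1n mul1r.
Qed.

Lemma ccw_eq0 u v w : bd u -> bd v -> bd w -> u <> v -> ccw u v w = 0 ->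
  w = u \/ w = v.
Proof.
move=> bu bv bw uv /eqP; rewrite !mulf_eq0 -orbA => /or3P[] /eqP e.
- by case: uv; exact: hdet_eq0.
- by right; apply/esym/hdet_eq0.
- by left; apply/hdet_eq0.
Qed.

(** * Powers of [rho] *)

Section Hecke.
Variables (q : nat) (hq : (3 <= q)%N).
Local Notation lam := (lambda R q).
Local Notation rho := (@rho R q).
Local Notation tau := (@tau R q).
Local Notation sigma := (@sigma R).

(* The entries of the matrix of [rho^n]. *)
Definition sinq (n : nat) : R := sin (n%:R * (pi / q%:R)) / sin (pi / q%:R).

Lemma q_gt0 : 0 < q%:R :> R. Proof. by rewrite ltr0n; case: q hq. Qed.

Lemma sin_mul_gt0 n : (0 < n < q)%N -> 0 < sin (n%:R * (pi / q%:R)) :> R.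
Proof.
move=> /andP[n0 nq]; apply: sin_gt0_pi;
  rewrite mulr_gt0 ?divr_gt0 ?pi_gt0 ?ltr0n ?q_gt0 //=.
- by rewrite mulrA ltr_pdivrMr ?q_gt0 // mulrC ltr_pM2l ?pi_gt0 // ltr_nat.
- by case: q hq.
Qed.

Lemma sin_pi_div_gt0 : 0 < sin (pi / q%:R) :> R.
Proof. by have := @sin_mul_gt0 1 (ltnW hq); rewrite mul1r. Qed.

Lemma sinq_gt0 n : (0 < n < q)%N -> 0 < sinq n.
Proof. by move=> nq; rewrite divr_gt0 ?sin_mul_gt0 ?sin_pi_div_gt0. Qed.

Lemma sinq0 : sinq 0 = 0. Proof. by rewrite /sinq mul0r sin0 mul0r. Qed.

Lemma sinq1 : sinq 1 = 1. Proof. by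
  rewrite /sinq mul1r divff ?gt_eqF ?sin_pi_div_gt0. Qed.

Lemma sinqq : sinq q = 0.
Proof. by rewrite /sinq mulrC [q%:R * _]mulrC divfK ?gt_eqF ?q_gt0 // sinpi mulr0. Qed.

Lemma sinqSS n : sinq n.+2 = lam * sinq n.+1 - sinq n.
Proof.
rewrite /sinq /lambda; set t := pi / _.
have -> : n.+2%:R * t = n.+1%:R * t + t by rewrite -[n.+2]addn1 natrD; ring.
have e : n%:R * t = n.+1%:R * t - t by rewrite -[n.+1]addn1 natrD; ring.
by rewrite e sinD sinB; ring.
Qed.

Lemma lam_gt0 : 0 < lam.
Proof.
have := sinqSS 0; rewrite sinq0 sinq1 subr0 mulr1 => <-.
by rewrite sinq_gt0.
Qed.

Lemma moebius_rho : moebius rho lam (- 1) 1 0.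
Proof.
by apply: moebius_eq (moebius_comp (moebius_tau q) moebius_sigma) _ _ _ _; ring.
Qed.

(** The last entry stands for minus the term of [sinq] of index [n - 1]; this form also makes sense
    at [n = 0]. *)
Lemma moebius_iter_rho n :
  moebius (iter n rho) (sinq n.+1) (- sinq n) (sinq n) (sinq n.+1 - lam * sinq n).
Proof.
elim: n => [|n IH].
  rewrite sinq0 sinq1; split=> [|p]; first by ring.
  by exists 1; rewrite ?oner_eq0 // !realCB; split; rewrite /=; ring.
by apply: moebius_eq (moebius_comp moebius_rho IH) _ _ _ _; rewrite ?sinqSS; ring.
Qed.

Lemma sinq_det n : sinq n.+1 ^+ 2 - sinq n * sinq n.+2 = 1.
Proof.
have [<- _] := moebius_iter_rho n.+1.
by rewrite !sinqSS; ring.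
Qed.

(** Since [sinq q] is 0, the matrix of the [q]-th power is scalar. *)
Lemma iter_rho_q p : iter q rho p = p.
Proof.
have [_ /(_ p) [k k0]] := moebius_iter_rho q.
rewrite sinqq mulr0 subr0 oppr0 !mul0r addr0 add0r !mulrA => -[e1 e2].
exact: hom_inj e1 e2.
Qed.

(** * Normal form of the elements of the Hecke group *)

Inductive positive_word : (option R[i] -> option R[i]) -> Prop :=
| pw_id : positive_word id
| pw_step n f of (0 < n < q)%N & positive_word f :
    positive_word (iter n rho \o (sigma \o f)).

(** The closed boundary arc from 0 to infinity through the positive reals. A product is used since
    its sign survives a common real factor of the coordinates. *)
Definition bd_ge0 p := bd p /\ 0 <= rhom1 p * rhom2 p.

Lemma iter_rho_sigma_ge0 n p : (0 < n < q)%N -> bd_ge0 p ->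
  bd_ge0 (iter n rho (sigma p)).
Proof.
move=> nq [bp p0]; have Mf := moebius_comp (moebius_iter_rho n) moebius_sigma.
have [bp' [k k0 [e1 e2]]] := moebius_bd Mf bp; split=> //.
rewrite /= in e1 e2; rewrite {}e1 {}e2.
(* The exponent is now [n.+1]. Up to a common sign, the entries of the matrix are [sinq n],
   [sinq n.+1] (twice) and [sinq n.+2]; the first vanishes for [n = 0] and the last for
   [n.+2 = q]. *)
case: n nq {Mf bp'} => // n nq.
have s0 : 0 <= sinq n.
  case: n nq => [|n] /andP[_ nq]; first by rewrite sinq0.
  by apply/ltW/sinq_gt0; exact: ltnW.
have s1 : 0 < sinq n.+1 by exact: sinq_gt0.
have s2 : 0 <= sinq n.+2.
  have [e|ne] := eqVneq n.+2 q; first by rewrite e sinqq.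
  by rewrite ltW // sinq_gt0 //= ltn_neqAle ne; case/andP: nq.
have r2 : 0 <= rhom2 p by case: (p) => [w|] /=; rewrite /rhom2 /= ?ler01.
have r1 : 0 <= rhom1 p.
  by move: p0; case: (p) => [w|] /=; rewrite /rhom2 /rhom1 /= ?mulr1 ?ler01.
set X := rhom1 p in r1 *; set Y := rhom2 p in r2 *.
rewrite sinqSS in s2 *.
rewrite [leRHS](_ : _ = k ^+ 2 * ((sinq n.+1 * X + (lam * sinq n.+1 - sinq n) * Y) *
   (sinq n * X + sinq n.+1 * Y))); last by ring.
by rewrite mulr_ge0 ?sqr_ge0 // mulr_ge0 // addr_ge0 // mulr_ge0 // ltW.
Qed.

Lemma positive_word_ge0 f p : positive_word f -> bd_ge0 p -> bd_ge0 (f p).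
Proof.
move=> wf; elim: wf p => {f} [//|n f nq _ IH] p p0.
by apply: iter_rho_sigma_ge0 => //; exact: IH.
Qed.

Definition reduced f := exists e1 e2 : bool, exists2 g, positive_word g &
  forall p, f p = iter e1 sigma (g (iter e2 sigma p)).

Lemma reduced_sigma f : reduced f -> reduced (sigma \o f).
Proof.
move=> [e1 [e2 [g wg fE]]]; exists (~~ e1), e2, g => // p.
by rewrite /= fE; case: e1 fE => _ //=; rewrite sigmaK.
Qed.

(** After a leading [sigma], or before an empty word, [rho] starts a new letter. Otherwise it raises
    the exponent of the first letter; if this reaches [q], the power of [rho] disappears and leaves
    a leading [sigma]. *)
Lemma reduced_rho f : reduced f -> reduced (rho \o f).
Proof.
have q1 : (0 < 1 < q)%N by exact: ltnW.
move=> [[] [e2 [g wg fE]]].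
  exists false, e2, (iter 1 rho \o (sigma \o g)); first exact: pw_step.
  by move=> p; rewrite /= fE.
case: wg fE => [|n h /andP[n0 nq] wh] fE.
  exists false, (~~ e2), (iter 1 rho \o (sigma \o id)).
    by apply: pw_step q1 _; exact: pw_id.
  by move=> p; rewrite /= fE /=; case: e2 fE => _ /=; rewrite ?sigmaK.
have [e|ne] := eqVneq n.+1 q; last first.
  exists false, e2, (iter n.+1 rho \o (sigma \o h)).
    by apply: pw_step wh; rewrite /= ltn_neqAle ne.
  by move=> p; rewrite /= fE.
exists true, e2, h => // p.
by rewrite /= fE /= -[LHS]/(iter n.+1 rho _) e iter_rho_q.
Qed.

Lemma reduced_iter_rho n f : reduced f -> reduced (iter n rho \o f).
Proof.
move=> rf; elim: n => [//|n IH].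
exact: (@reduced_rho (iter n rho \o f)).
Qed.

Lemma eq_reduced f g : f =1 g -> reduced f -> reduced g.
Proof. by move=> fg [e1 [e2 [h wh fE]]]; exists e1, e2, h => // p; rewrite -fg. Qed.

(** Stated for left multiplication so that induction on [generated] applies; the second half serves
    the constructor [gen_inv]. *)
Lemma Hecke_reduced_comp f : Hecke q f ->
  (forall g, reduced g -> reduced (f \o g)) /\
  (forall f', cancel f' f -> forall g, reduced g -> reduced (f' \o g)).
Proof.
elim=> {f} [f [->|->]| |f g Hf [If If'] Hg [Ig Ig']|f g Hf [If If'] fK gK].
- split; first exact: reduced_sigma.
  move=> f' fK g /reduced_sigma; apply: eq_reduced => p /=.
  by rewrite -{1}(fK (g p)) sigmaK.
- split=> [g /reduced_sigma /reduced_rho|f' fK g].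
    by apply: eq_reduced => p /=; rewrite /Defs.rho sigmaK.
  (* The inverse of [tau] is [sigma] after the power [q.-1] of [rho]. *)
  move=> /(reduced_iter_rho q.-1) /reduced_sigma; apply: eq_reduced => p /=.
  rewrite -[in LHS](fK (g p)) -[f' (g p) in LHS]sigmaK.
  rewrite -/(rho (sigma (f' (g p)))) -iterSr prednK; last by case: q hq.
  by rewrite iter_rho_q sigmaK.
- split=> // f' fK g; apply: eq_reduced => p /=; exact/esym/fK.
- split=> [h rh|h hK k rk]; first by apply: (If (g \o h)); exact: Ig.
  have [f1 Hf1 [f1K f1K']] := Hecke_inv Hf.
  have [g1 Hg1 [g1K g1K']] := Hecke_inv Hg.
  have := Ig' _ g1K' _ (If' _ f1K' _ rk); apply: eq_reduced => p /=.
  by rewrite -{1}(hK (k p)) /= f1K g1K.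
- split=> [h rh|f' f'K h rh]; first exact: If'.
  have := If h rh; apply: eq_reduced => p /=.
  by rewrite -{1}(f'K (h p)) gK.
Qed.

Lemma Hecke_reduced f : Hecke q f -> reduced f.
Proof.
move=> /Hecke_reduced_comp[Hf _]; apply: (Hf id).
by exists false, false, id => //; exact: pw_id.
Qed.

Lemma Hecke_bd f p : Hecke q f -> bd p -> bd (f p).
Proof.
move=> /Hecke_moebius[a [b [c [d Mf]]]] bp.
by have [] := moebius_bd Mf bp.
Qed.

(* That is, no edge crosses the edge from 0 to infinity: points of the line on
   either side of that edge are told apart by the sign of [rhom1 * rhom2]. *)
Lemma Hecke_same_sign f : Hecke q f ->
  0 <= rhom1 (f None) * rhom2 (f None) * (rhom1 (f (Some 0)) * rhom2 (f (Some 0))).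
Proof.
move=> Hf; have [e1 [e2 [g wg fE]]] := Hecke_reduced Hf.
have gI : bd_ge0 (g None).
  by apply: positive_word_ge0 => //; split; rewrite // /rhom2 /= mulr0.
have g0 : bd_ge0 (g (Some 0)).
  by apply: positive_word_ge0 => //; split; rewrite // /rhom1 /= mul0r.
suff H : 0 <= rhom1 (iter e1 sigma (g None)) * rhom2 (iter e1 sigma (g None)) *
   (rhom1 (iter e1 sigma (g (Some 0))) * rhom2 (iter e1 sigma (g (Some 0)))).
  (* A [sigma] on the right exchanges 0 and infinity, hence only the two factors. *)
  by rewrite !fE; case: e2 fE => _ //=; rewrite eqxx mulrC.
case: gI g0 => [bI I0] [b0 z0].
case: e1 fE => _ /=; last by rewrite mulr_ge0.
(* A [sigma] on the left reverses the sign of both factors, up to squares. *)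
have [_ [k k0 [-> ->]]] := moebius_bd moebius_sigma bI.
have [_ [l l0 [-> ->]]] := moebius_bd moebius_sigma b0.
set X := rhom1 _ * rhom2 _ in I0; set Y := rhom1 _ * rhom2 _ in z0.
rewrite [leRHS](_ : _ = k ^+ 2 * l ^+ 2 * (X * Y)); last by rewrite /X /Y; ring.
by rewrite mulr_ge0 // mulr_ge0 // sqr_ge0.
Qed.


(** * Edges do not cross; shortest paths and separating edges *)

Lemma Hecke_sigma : Hecke q sigma. Proof. by apply: gen_in; left. Qed.
Lemma Hecke_tau : Hecke q tau. Proof. by apply: gen_in; right. Qed.

Lemma Hecke_iter_rho n : Hecke q (iter n rho).
Proof.
elim: n => [|n IH]; first exact: gen_id.
exact: gen_comp (gen_comp Hecke_tau Hecke_sigma) IH.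
Qed.

Lemma farey_adjI g : Hecke q g -> farey_adj q (g None) (g (Some 0)).
Proof. by move=> Hg; exists g => //; rewrite setUC. Qed.

(** Composing [g] with [sigma] on the right exchanges the two ends, so their order can be
    prescribed. *)
Lemma farey_adjE u v : farey_adj q u v ->
  exists2 g, Hecke q g & u = g None /\ v = g (Some 0).
Proof.
move=> [g Hg e]; have [g' _ [gK _]] := Hecke_inv Hg.
have hu : [set g (ezero R); g (einf R)] u by rewrite -e; left.
have hv : [set g (ezero R); g (einf R)] v by rewrite -e; right.
have h0 : [set u; v] (g (ezero R)) by rewrite e; left.
have hI : [set u; v] (g (einf R)) by rewrite e; right.
have ne : g (ezero R) <> g (einf R) by move=> /(can_inj gK).
case: hu hv h0 hI => -> [] -> //=.
- by move=> _ [] /esym /ne.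
- move=> _ _; exists (g \o sigma); first exact: gen_comp Hecke_sigma.
  by rewrite /= eqxx.
- by move=> _ _; exists g.
- by move=> [] /ne.
Qed.

Lemma farey_vertex_bd u : farey_vertex q u -> bd u.
Proof. by move=> [g Hg ->]; exact: Hecke_bd. Qed.

Lemma farey_adj_vertex u v : farey_adj q u v -> farey_vertex q v.
Proof.
move=> /farey_adjE[g Hg [_ ->]]; exists (g \o sigma) => //.
exact: gen_comp Hecke_sigma.
Qed.

(** Move the edge [a b] to the one from infinity to 0: there [ccw None (Some 0) u] is
    [rhom1 u * rhom2 u], and [Hecke_same_sign] applies. *)
Lemma farey_adj_noncrossing a b u w : farey_adj q a b -> farey_adj q u w ->
  0 <= ccw a b u * ccw a b w.
Proof.
move=> /farey_adjE[f Hf [-> ->]] /farey_adjE[g Hg [-> ->]].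
have [f' Hf' [_ fK]] := Hecke_inv Hf.
have [? [? [? [? Mf]]]] := Hecke_moebius Hf.
have Hh : Hecke q (f' \o g) by exact: gen_comp.
have bdN : bd None by [].
have bd0 : bd (Some 0) by [].
have [l l0 e1] := ccw_moebius Mf bdN bd0 (Hecke_bd Hh bdN).
have [k k0 e2] := ccw_moebius Mf bdN bd0 (Hecke_bd Hh bd0).
rewrite /= !fK in e1 e2; rewrite e1 e2.
have := Hecke_same_sign Hh; rewrite /= /ccw /hdet {3 4 7 8}/rhom1 {3 4 7 8}/rhom2 /=.
set X := rhom1 _; set Y := rhom2 _; set X' := rhom1 _; set Y' := rhom2 _ => H.
rewrite /rhom1 /rhom2 /= [leRHS](_ : _ = l * k * (X * Y * (X' * Y'))); last by ring.
by rewrite mulr_ge0 // mulr_ge0 // ltW.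
Qed.

(** A discrete intermediate value theorem: no step leads from one strict sign to the other. *)
Lemma path_sign_change (T : eqType) (e : rel T) (phi : T -> R) (x : T) s :
  (forall y z, e y z -> 0 <= phi y * phi z) -> path e x s ->
  phi x * phi (last x s) <= 0 -> exists2 y, y \in x :: s & phi y = 0.
Proof.
move=> He; elim: s x => [|c s IH] x /=.
  move=> _ h; exists x; rewrite ?mem_head //; apply/eqP.
  by rewrite -sqrf_eq0 eq_le expr2 h -expr2 sqr_ge0.
move=> /andP[/He xc ps] xl.
have [x0|x0] := eqVneq (phi x) 0; first by exists x; rewrite ?mem_head.
have [|y ys y0] := IH c ps; last by exists y; rewrite // inE ys orbT.
have x2 : 0 < phi x ^+ 2 by rewrite exprn_even_gt0.
rewrite -(pmulr_rle0 _ x2).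
rewrite [leLHS](_ : _ = (phi x * phi c) * (phi x * phi (last c s))); last by ring.
by rewrite mulr_ge0_le0.
Qed.

Lemma farey_path_vertex x (p : seq (option R[i])) u : farey_vertex q x ->
  farey_path q x p ->
  u \in x :: p -> farey_vertex q u.
Proof.
move=> vx; elim: p x vx => [|c p IH] x vx /=; first by rewrite inE => _ /eqP ->.
move=> /andP[/asboolP /farey_adj_vertex vc pp]; rewrite inE => /orP[/eqP -> //|].
exact: IH.
Qed.

Lemma geodesic_not_separated x y (p : seq (option R[i])) v a b : farey_vertex q x ->
  geodesic_path q x y p -> v \in x :: p -> farey_adj q a b ->
  ccw a b v != 0 -> ccw a b x * ccw a b v <= 0 -> ccw a b v * ccw a b y <= 0 ->
  False.
Proof.
move=> vx [pp lp geo] vp ab v0 xv vy.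
have bda : bd a.
  by case/farey_adjE: ab => g Hg [-> _]; exact: Hecke_bd.
have bdb : bd b by exact/farey_vertex_bd/(farey_adj_vertex ab).
have nab : a <> b.
  case/farey_adjE: ab => g Hg [-> ->]; have [g' _ [gK _]] := Hecke_inv Hg.
  by move=> /(can_inj gK).
have ab' : farey_adj q b a by case: ab => g Hg e; exists g; rewrite // setUC.
have ends u : u \in x :: p -> ccw a b u = 0 -> u = a \/ u = b.
  move=> /(farey_path_vertex vx pp) /farey_vertex_bd bu.
  exact: ccw_eq0.
have nc u w : `[< farey_adj q u w >] -> 0 <= ccw a b u * ccw a b w.
  by move=> /asboolP; exact: farey_adj_noncrossing.
(* Cut the path at [v]; by the sign of [ccw a b], both halves contain a zero, which is [a] or
   [b]. *)
case/splitPl: vp pp lp geo ends => p1 p2 lv pp lp geo ends.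
move: pp; rewrite /farey_path cat_path lv => /andP[pp1 pp2].
rewrite last_cat lv in lp.
have [|u us u0] := path_sign_change nc pp1; first by rewrite lv.
have [|w ws w0] := path_sign_change nc pp2; first by rewrite lp.
have uE : u = a \/ u = b.
  by apply: ends => //; rewrite -cat_cons mem_cat us.
have wE : w = a \/ w = b.
  apply: ends => //; rewrite -cat_cons mem_cat; move: ws;
    rewrite inE => /orP[/eqP ->|->].
    by rewrite -lv mem_last.
  by rewrite orbT.
have uv : u != v by apply: contraNneq v0 => <-; rewrite u0.
have wv : w != v by apply: contraNneq v0 => <-; rewrite w0.
case/splitPl: us pp1 lv geo {ends} => p11 p12 lu; rewrite cat_path lu last_cat lu.
move=> /andP[pp11 pp12] lv geo.
case/splitPl: ws pp2 lp geo => p21 p22 lw; rewrite cat_path lw last_cat lw.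
move=> /andP[pp21 pp22] lp geo.
have n12 : (0 < size p12)%N.
  by case: p12 lv {pp12 geo} => //= e; rewrite e eqxx in uv.
have n21 : (0 < size p21)%N.
  by case: p21 lw {pp21 geo} => //= e; rewrite e eqxx in wv.
(* Here [j] and [k] are the lengths from [u] to [v] and from [v] to [w]. Together they are at least
   2, so replacing them by at most one edge shortens the path. *)
have arith (i j k l : nat) : (0 < j)%N -> (0 < k)%N ->
  (i + j + (k + l) <= i + l.+1)%N -> False.
  by lia.
have [uw|nuw] := eqVneq u w.
  have := geo (p11 ++ p22); rewrite /farey_path cat_path pp11 lu uw pp22 last_cat lu uw.
  move=> /(_ isT lp); rewrite !size_cat => le12.
  by apply: arith n12 n21 (leq_trans le12 _); rewrite leq_add2l.
have uwadj : farey_adj q u w.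
  by case: uE wE nuw => -> [] ->; rewrite ?eqxx.
have := geo (p11 ++ w :: p22).
rewrite /farey_path cat_path pp11 lu /= pp22 last_cat /= andbT.
move=> /(_ (asboolT uwadj) lp); rewrite !size_cat /=.
exact: arith n12 n21.
Qed.

(** * The polygon [E], its interior and its images *)

Definition ev n : R := sinq n.+1 / sinq n.

Lemma iter_rho_None n : (0 < n < q)%N -> iter n rho None = Some (ev n)%:C.
Proof.
move=> nq; have [_ /(_ None) [k k0]] := moebius_iter_rho n.
rewrite /= !mulr1 !mulr0 !addr0 => -[e1 e2].
apply: (hom_inj (k := k * (sinq n)%:C)); rewrite /= ?mulr1 ?mulr0 //.
by rewrite e1 -mulrA -realCM [sinq n * _]mulrC divfK // gt_eqF // sinq_gt0.
Qed.

Lemma ev1 : ev 1 = lam.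
Proof. by rewrite /ev sinqSS sinq1 sinq0 mulr1 subr0 divr1. Qed.

Lemma ev_last : ev q.-1 = 0.
Proof. by rewrite /ev prednK ?sinqq ?mul0r //; case: q hq. Qed.

(** By [sinq_det] the difference of the two values is the inverse of [sinq n * sinq n.+1]. *)
Lemma ev_lt n : (0 < n)%N -> (n.+1 < q)%N -> ev n.+1 < ev n.
Proof.
move=> n0 nq; have s1 : 0 < sinq n by apply: sinq_gt0; rewrite n0 ltnW.
have s2 : 0 < sinq n.+1 by exact: sinq_gt0.
rewrite /ev ltr_pdivrMr // mulrAC ltr_pdivlMr // -subr_gt0.
by rewrite -expr2 [_ * sinq n]mulrC sinq_det.
Qed.

Lemma ev_le m n : (0 < m)%N -> (m <= n)%N -> (n < q)%N -> ev n <= ev m.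
Proof.
move=> m0 /subnK <-; elim: (n - m)%N => [//|k IH] kq.
apply: le_trans (IH (ltnW kq)); apply/ltW/ev_lt => //.
by rewrite addn_gt0 m0 orbT.
Qed.

Lemma ev_bounds n : (0 < n < q)%N -> 0 <= ev n <= lam.
Proof.
move=> /andP[n0 nq]; rewrite -ev1 -ev_last !ev_le //=.
- by case: q nq.
- by case: q hq.
Qed.

(** Apply [iter n rho \o tau] to the edge from infinity to 0: [tau] fixes infinity and sends 0 to
    [lam], the image of infinity under [rho]. *)
Lemma ev_adj n : (0 < n)%N -> (n.+1 < q)%N ->
  farey_adj q (Some (ev n)%:C) (Some (ev n.+1)%:C).
Proof.
move=> n0 nq; rewrite -!iter_rho_None ?n0 ?nq ?(ltnW nq) //.
have := @farey_adjI (iter n rho \o tau) (gen_comp (Hecke_iter_rho n) Hecke_tau).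
by rewrite iterSr.
Qed.

(** The open polygon: strictly between the two vertical sides and strictly outside the semicircles
    with ends [ev n] and [ev n.+1]. *)
Definition inner_E : set R[i] := [set z | [/\ 0 < Im z, 0 < Re z, Re z < lam
  & forall n : 'I_q, (0 < n)%N -> (n.+1 < q)%N ->
    0 < (Re z - ev n) * (Re z - ev n.+1) + Im z ^+ 2]].

Lemma E_vertexE (j : 'I_q) :
  E_vertex R j = if j == 0 :> nat then None else Some (ev j)%:C.
Proof.
case: eqP => [j0|/eqP j0]; first by rewrite /E_vertex j0.
by rewrite /E_vertex iter_rho_None // lt0n j0 ltn_ord.
Qed.

Lemma inner_E_sub : inner_E `<=` E q.
Proof.
move=> z [zi z0 zl zn]; split=> // i j.
have b (k : 'I_q) : k != 0 :> nat -> 0 <= ev k <= lam.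
  by move=> k0; rewrite ev_bounds // lt0n k0 ltn_ord.
rewrite !E_vertexE /=.
(* Side 0 is the vertical line at [lam], side [q.-1] the one at 0, and the others are
   semicircles. *)
have [i0|i0] := eqVneq (i : nat) 0.
  rewrite i0 modn_small 1?ltnW //= ev1.
  have [_|/b /andP[_ h]] /= := eqVneq (j : nat) 0; first by rewrite mulr0.
  by rewrite mulr_le0 // subr_le0 // ltW.
have [iq|iq] := eqVneq i.+1 q.
  have -> : (i.+1 %% q = 0)%N by rewrite iq modnn.
  have -> : i = q.-1 :> nat by exact: (congr1 predn iq).
  rewrite ev_last /= subr0.
  have [_|/b /andP[h _]] /= := eqVneq (j : nat) 0; first by rewrite mulr0.
  by rewrite subr0 mulr_ge0 // ltW.
have {}iq : (i.+1 < q)%N by rewrite ltn_neqAle iq ltn_ord.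
rewrite modn_small //=; rewrite -lt0n in i0.
have := zn i i0 iq; set X := _ + _ => X0.
rewrite [X in 0 <= X * _](_ : _ = X); last by rewrite /X; field.
apply: mulr_ge0; first exact: ltW.
have [_|j0] /= := eqVneq (j : nat) 0; first exact: ler01.
rewrite [leRHS](_ : _ = (ev j - ev i) * (ev j - ev i.+1)); last by field.
have [ji|ij] := leqP j i.
  have := @ev_le j i; rewrite lt0n j0 => /(_ isT ji (ltn_ord i)) h1.
  have h2 := ev_lt i0 iq.
  by rewrite mulr_ge0 // subr_ge0 // ltW // (lt_le_trans h2).
have h1 := @ev_le i.+1 j isT ij (ltn_ord j).
have h2 := ev_lt i0 iq.
by rewrite mulr_le0 // subr_le0 // ltW // (le_lt_trans h1).
Qed.

Lemma inner_E_open (z : R[i]^o) : inner_E z -> nbhs z inner_E.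
Proof.
have FF : ProperFilter (nbhs z) by exact: nbhs_pfilter.
move=> [zi z0 zl zn].
have cR := @Re_continuous z; have cI := @Im_continuous z.
have H (n : 'I_q) : nbhs z [set w : R[i] | (0 < n)%N -> (n.+1 < q)%N ->
    0 < (Re w - ev n) * (Re w - ev n.+1) + Im w ^+ 2].
  have [n0|/negP n0] := boolP (0 < n)%N; last by apply: (@filterE _ _ FF) => w h;
    case: n0.
  have [nq|/negP nq] := boolP (n.+1 < q)%N; last by apply: (@filterE _ _ FF) => w _ h;
    case: nq.
  have : ((Re w - ev n) * (Re w - ev n.+1) + Im w * Im w) @[w --> z] -->
          ((Re z - ev n) * (Re z - ev n.+1) + Im z * Im z).
    apply: cvgD; last exact: cvgM.
    by apply: cvgM; apply: cvgB => //; exact: cvg_cst.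
  move=> /cvgr_gt /(_ _ (zn n n0 nq)).
  by apply: (@filterS _ _ FF) => w; rewrite /= expr2.
have {}H := filter_forall FF H.
have h1 := cvgr_gt _ cI _ zi; have h2 := cvgr_gt _ cR _ z0; have h3 :=
  cvgr_lt _ cR _ zl.
have I2 := @filterI _ (nbhs z) FF.
have HH := I2 _ _ (I2 _ _ H (h1 FF)) (I2 _ _ (h2 FF) (h3 FF)).
refine (@filterS _ (nbhs z) FF _ inner_E _ HH) => w [[h4 h5] [h6 h7]].
by split.
Qed.

(** The witness is the image of [z]. It is interior to the face because the inverse of [g] is a
    continuous homography near it, which pulls the open set [inner_E] back to a neighbourhood. *)
Lemma crossed_moebius x y g z : Hecke q g -> inner_E z -> bd x -> bd y -> x <> y ->
  side x y (Some z) = 0 -> crossed q (g x) (g y) g.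
Proof.
move=> Hg zE bx yb xy sz; split=> //.
have [a [b [c [d Mg]]]] := Hecke_moebius Hg.
have [g' _ [gK g'K]] := Hecke_inv Hg.
have Mg' := moebius_inv g'K Mg.
have zi : 0 < Im z by case: zE.
have [k k0 [gz _ wi]] := moebius_upper Mg zi; set w := k * _ in gz wi.
exists w; split; last first.
  split=> //; apply/side_line_form; rewrite ?(Hecke_bd _ bx) ?(Hecke_bd _ yb) //.
  - exact: Hecke_bd.
  - exact: Hecke_bd.
  - by move=> /(can_inj gK).
  - by apply: (moebius_line Mg) gz _ => //; exact: (side_line_form z bx yb xy).1.
have hom (u : R[i]) : 0 < Im u -> (- c)%:C * u + a%:C != 0 /\
   g' (Some u) = Some ((d%:C * u + (- b)%:C) / ((- c)%:C * u + a%:C)).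
  move=> ui; have [l l0 [-> e _]] := moebius_upper Mg' ui.
  have n0 : (- c)%:C * u + a%:C != 0.
    by apply: contra_eq_neq e => ->; rewrite mulr0 eq_sym oner_eq0.
  split=> //; congr Some; apply: (mulIf n0).
  by rewrite divfK // mulrAC e mul1r.
have [w0 wz] := hom w wi; rewrite -gz gK in wz; case: wz => wz.
have FF : ProperFilter (nbhs (w : R[i]^o)) by exact: nbhs_pfilter.
have cF := @homography_continuous d%:C (- b)%:C (- c)%:C a%:C w w0; rewrite -wz in cF.
have h1 : nbhs (w : R[i]^o) [set u : R[i] | 0 < Im u].
  exact: cvgr_gt _ (@Im_continuous w) _ wi.
have h2 := @filterI _ (nbhs (w : R[i]^o)) FF _ _ h1 (cF _ (inner_E_open zE)).
refine (@filterS _ _ FF _ (face q g) _ h2) => u [ui /= uE].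
exists ((d%:C * u + (- b)%:C) / ((- c)%:C * u + a%:C)); first exact: inner_E_sub.
by rewrite -(proj2 (hom u ui)) g'K.
Qed.

(** * Hyperbolic lines that meet [inner_E] *)

Lemma inner_E_vertical (b : R) : 0 < b < lam ->
  exists2 z, inner_E z & side None (Some b%:C) (Some z) = 0.
Proof.
(* All semicircular sides have their ends in [[0, lam]], so this height clears them. *)
move=> /andP[b0 bl]; exists (b +i* (lam + 1)); last by rewrite /= subrr.
have l0 := lam_gt0.
split=> //=; first by rewrite addr_gt0.
move=> n n0 nq.
have /andP[h1 h2] : 0 <= ev n <= lam by apply: ev_bounds; rewrite n0 ltnW.
have /andP[h3 h4] : 0 <= ev n.+1 <= lam by exact: ev_bounds.
have h5 : 0 <= (b - ev n + lam) * (b - ev n.+1 + lam) by apply: mulr_ge0; lra.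
have h6 : 0 <= (lam - b + ev n) * (lam - b + ev n.+1) by apply: mulr_ge0; lra.
nra.
Qed.

Lemma inner_E_across_side (x y : R) : x < 0 -> 0 < y ->
  exists2 z, inner_E z & side (Some x%:C) (Some y%:C) (Some z) = 0.
Proof.
move=> x0 y0; have l0 := lam_gt0.
(* The abscissa of the witness is [r = t * y], close to the vertical side at 0. As a product of two
   numbers in [(0, 1)], [t] is below both: one bound gives [r < lam], the other
   [r * (lam - x) < - x * y], which lifts the point above the semicircular sides. *)
pose t := - x / (lam - x) * (lam / (y + lam)).
have [t0 t1 t2] : [/\ 0 < t, t < lam / (y + lam) & t < - x / (lam - x)].
  have h1 : 0 < - x / (lam - x) < 1 by rewrite divr_gt0 ?ltr_pdivrMr ?mul1r; lra.
  have h2 : 0 < lam / (y + lam) < 1 by rewrite divr_gt0 ?ltr_pdivrMr ?mul1r; lra.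
  case/andP: h1 h2 => h1 h1' /andP[h2 h2']; rewrite /t; split.
  - by rewrite mulr_gt0.
  - by rewrite gtr_pMl.
  - by rewrite gtr_pMr.
have d1 : 0 < lam - x by lra.
have d2 : 0 < y + lam by lra.
rewrite ltr_pdivlMr // in t1; rewrite ltr_pdivlMr // in t2.
have ty : t * y < lam by nra.
pose r := t * y.
have r0 : 0 < r by rewrite mulr_gt0.
have ry : r < y by rewrite /r; nra.
have rx : r * (lam - x) < - x * y by rewrite /r mulrAC ltr_pM2r.
have s0 : 0 <= (r - x) * (y - r) by apply: mulr_ge0; lra.
have s1 : 0 < (r - x) * (y - r) by apply: mulr_gt0; lra.
exists (r +i* Num.sqrt ((r - x) * (y - r))); last first.
  by rewrite /= sqr_sqrtr //; field.
split=> //=; first by rewrite sqrtr_gt0.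
move=> n n0 nq; rewrite sqr_sqrtr //.
have /andP[h1 h2] : 0 <= ev n <= lam by apply: ev_bounds; rewrite n0 ltnW.
have /andP[h3 h4] : 0 <= ev n.+1 <= lam by exact: ev_bounds.
suff : - (r * lam) <= (r - ev n) * (r - ev n.+1) by nra.
have h5 := ev_lt n0 nq.
have [h6|h6] := lerP (ev n) r.
  by apply: (@le_trans _ _ 0); [rewrite oppr_le0 mulr_ge0 ?ltW|rewrite mulr_ge0; lra].
have [h7|h7] := lerP r (ev n.+1).
  by apply: (@le_trans _ _ 0); [rewrite oppr_le0 mulr_ge0 ?ltW|rewrite mulr_le0; lra].
rewrite -subr_ge0 opprK [leRHS](_ : _ = r * (lam - (ev n - r)) + ev n.+1 * (ev n - r));
  last by ring.
by rewrite addr_ge0 // mulr_ge0; lra.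
Qed.

Lemma inner_E_below (x y : R) : 0 <= x -> x < y -> y <= lam ->
  (exists2 z, inner_E z & side (Some x%:C) (Some y%:C) (Some z) = 0) \/
  (exists n, [/\ (0 < n)%N, (n.+1 < q)%N, ev n.+1 <= x & y <= ev n]).
Proof.
move=> x0 xy yl.
have q1 : (0 < q.-1 < q)%N by case: q hq => [|[]] //= n _; rewrite ltnS leqnn.
have exn : exists n, (0 < n)%N && (ev n <= x).
  by exists q.-1; rewrite ev_last x0 andbT; case/andP: q1.
(* As [ev] decreases, the least positive index [m] with [ev m <= x] finds the interval between
   consecutive vertices that contains [x]. *)
case: (ex_minnP exn) => m /andP[m0 mx] mmin.
have mq : (m < q)%N.
  by rewrite (leq_ltn_trans (mmin q.-1 _)) ?ev_last ?x0 ?andbT //; case/andP: q1.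
case: m m0 mx mmin mq => [//|[|n]] _ mx mmin mq.
  by rewrite ev1 in mx; lra.
have xn : x < ev n.+1.
  by rewrite ltNge; apply/negP => h; have := mmin n.+1 h; rewrite ltnn.
have [yn|yn] := lerP y (ev n.+1); first by right; exists n.+1.
(* The vertex [e] lies strictly between [x] and [y]. The witness is the point of the line above it:
   [e] is strictly inside no interval between consecutive vertices. *)
left; set e := ev n.+1 in xn yn *.
have s1 : 0 < (e - x) * (y - e) by apply: mulr_gt0; lra.
exists (e +i* Num.sqrt ((e - x) * (y - e))); last first.
  by rewrite /= sqr_sqrtr ?ltW //; field.
split=> /=; [by rewrite sqrtr_gt0|by lra|by lra|move=> k k0 kq].
rewrite sqr_sqrtr ?ltW // ltr_wpDl //.
have h := ev_lt k0 kq.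
have [nk|kn] := leqP n.+1 k.
  have h1 : ev k <= e by apply: ev_le.
  by rewrite mulr_ge0; lra.
have h1 : e <= ev k.+1 by apply: ev_le => //; exact: ltnW.
by rewrite mulr_le0; lra.
Qed.

(** * Translations, and the faces at a given vertex *)

Lemma Hecke_int_translation (n : int) : exists2 t, Hecke q t &
  t None = None /\ forall w, t (Some w) = Some (w + (n%:~R * lam)%:C).
Proof.
have H (m : nat) : Hecke q (iter m tau) /\
    forall p, iter m tau p = omap (fun w => w + (m%:R * lam)%:C) p.
  elim: m => [|m [Hm IH]].
    by split=> [|[w|]] //=; [exact: gen_id|rewrite mul0r addr0].
  split=> [|p]; first exact: gen_comp Hecke_tau Hm.
  rewrite iterS IH; case: p => //= w; congr Some.
  by rewrite -addrA -realCD -natr1 mulrDl mul1r.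
case: n => m; first by have [Hm E] := H m; exists (iter m tau); rewrite // E;
  split=> // w; rewrite E.
have [Hm E] := H m.+1; have [t Ht [tK Kt]] := Hecke_inv Hm.
exists t => //; split=> [|w]; first by rewrite -[RHS]tK E.
rewrite -[RHS]tK E /=; congr (t (Some _)).
by rewrite -addrA -realCD NegzE mulrNz mulNr addNr addr0.
Qed.

Lemma Hecke_translation (b : R) : exists2 t, Hecke q t & t None = None /\
  exists2 s, 0 <= s < lam & forall c, t (Some c%:C) = Some (c + (b - s))%:C.
Proof.
have l0 := lam_gt0.
have [t Ht [tN tS]] := Hecke_int_translation (Num.floor (b / lam)).
exists t => //; split=> //.
(* This is [b] reduced modulo [lam], which the translation [t] carries back to [b]. *)
exists (b - (Num.floor (b / lam))%:~R * lam).
  have /andP[] := floor_itv (b / lam).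
  by rewrite ler_pdivlMr // ltr_pdivrMr // intrD mulrDl mul1r => ? ?; apply/andP;
    split; lra.
by move=> c; rewrite tS -realCD; congr (Some _%:C); ring.
Qed.

Lemma side_sym x y z : side x y z = side y x z :> R.
Proof. by case: x y z => [[a a']|] [[b b']|] [[w w']|] //=; field. Qed.

Lemma crossed_sym x y g : crossed q x y g -> crossed q y x g.
Proof.
move=> [Hg [w [wF [w0 wl]]]]; split=> //; exists w; split=> //.
by split=> //; rewrite side_sym.
Qed.

Lemma bd_real u : bd u -> u <> None -> exists b : R, u = Some b%:C.
Proof. by case: u => [[a b]|] //= -> _; exists a. Qed.

(** With [v] at infinity and [y] translated to [s] in [[0, lam)], non-adjacency excludes [s = 0],
    and the vertical line at [s] runs through the interior of [E]. *)
Lemma crossed_at_end v y : farey_vertex q v -> farey_vertex q y -> v <> y ->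
  ~ farey_adj q v y -> exists2 g, g None = v & crossed q v y g.
Proof.
move=> [g Hg ->] vy gy nadj; have [g' Hg' [gK g'K]] := Hecke_inv Hg.
have [|b yE] := bd_real (Hecke_bd Hg' (farey_vertex_bd vy)).
  by move=> /(congr1 g); rewrite g'K => /esym.
have [t Ht [tN [s /andP[s0 sl] tS]]] := Hecke_translation b.
have Hgt : Hecke q (g \o t) by exact: gen_comp.
have ty : g (t (Some s%:C)) = y by rewrite tS addrC subrK -yE g'K.
have s1 : 0 < s.
  rewrite lt_neqAle s0 andbT; apply/negP => /eqP e; apply: nadj.
  by rewrite -ty -e /einf -tN; exact: farey_adjI Hgt.
have [|z zE zl] := @inner_E_vertical s; first by rewrite s1.
exists (g \o t); first by rewrite /= tN.
by have := @crossed_moebius None (Some s%:C) _ _ Hgt zE I erefl _ zl; rewrite /= tN ty;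
  apply.
Qed.

Lemma crossed_or_separated v x y (c d : R) g : Hecke q g -> v = g None ->
  x = g (Some c%:C) -> y = g (Some d%:C) -> c < d ->
  (exists2 h, h None = v & crossed q x y h) \/
  (exists a b, [/\ farey_adj q a b, ccw a b v != 0,
     ccw a b x * ccw a b v <= 0 & ccw a b y * ccw a b v <= 0]).
Proof.
move=> Hg -> -> -> cd.
have [t Ht [tN [s /andP[s0 sl] tS]]] := Hecke_translation c.
have Hgt : Hecke q (g \o t) by exact: gen_comp.
pose r := s + (d - c).
have tx : t (Some s%:C) = Some c%:C by rewrite tS addrC subrK.
have ty : t (Some r%:C) = Some d%:C by rewrite tS; congr (Some _%:C); rewrite /r; ring.
have sr : s < r by rewrite /r; lra.
have ne (a b : R) : a < b -> Some a%:C <> Some b%:C.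
  by move=> ab [] e; rewrite e ltxx in ab.
have [rl|lr] := lerP r lam.
  have [[z zE zl]|[n [n0 nq nx ny]]] := inner_E_below s0 sr rl.
    left; exists (g \o t); first by rewrite /= tN.
    have := @crossed_moebius (Some s%:C) (Some r%:C) _ _ Hgt zE erefl erefl
      (ne _ _ sr) zl.
    by rewrite /= tx ty.
  right; have [? [? [? [? Mf]]]] := Hecke_moebius Hgt.
  pose a : option R[i] := Some (ev n)%:C; pose b : option R[i] := Some (ev n.+1)%:C.
  exists (g (t a)), (g (t b)).
  have ab := ev_lt n0 nq.
  have bda : bd a by []. have bdb : bd b by [].
  have [l l0 /= eV] := ccw_moebius Mf bda bdb (I : bd None).
  have [k k0 /= ex] := ccw_moebius Mf bda bdb (erefl : bd (Some s%:C)).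
  have [m m0 /= ey] := ccw_moebius Mf bda bdb (erefl : bd (Some r%:C)).
  rewrite tN in eV; rewrite tx in ex; rewrite ty in ey; rewrite eV ex ey.
  (* Infinity is strictly on one side of the edge, the interval between its ends weakly on the
     other. *)
  have vN : ccw a b None < 0 by rewrite /ccw /hdet /rhom1 /rhom2 /=; lra.
  have vp (u : R) : ev n.+1 <= u -> u <= ev n -> 0 <= ccw a b (Some u%:C).
    move=> h1 h2; rewrite /ccw /hdet /rhom1 /rhom2 /=.
    rewrite [leRHS](_ : _ = (ev n - ev n.+1) * ((u - ev n.+1) * (ev n - u)));
      last by ring.
    by apply: mulr_ge0; [lra|apply: mulr_ge0; lra].
  have sgn i j (A B : R) : 0 < i -> 0 < j -> 0 <= A -> B < 0 -> i * A * (j * B) <= 0.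
    move=> i0 j0 A0 B0; apply: mulr_ge0_le0; first by rewrite mulr_ge0 // ltW.
    by rewrite pmulr_rle0 // ltW.
  split.
  - case: (ev_adj n0 nq) => h Hh e; exists ((g \o t) \o h); first exact: gen_comp.
    by have := congr1 (fun A => (g \o t) @` A) e; rewrite !image_setU !image_set1.
  - by apply: mulf_neq0; [rewrite gt_eqF|rewrite lt_eqF].
  - by apply: sgn => //; apply: vp => //; lra.
  - by apply: sgn => //; apply: vp => //; lra.
(* Now [s < lam < r]: translating by [- lam] puts the ends on either side of 0, and the line crosses
   the vertical side there. *)
left; have l0 := lam_gt0.
have [||z zE zl] := @inner_E_across_side (s - lam) (r - lam); [lra|lra|].
have Ht' : Hecke q (g \o (t \o tau)) by exact: gen_comp Hg (gen_comp Ht Hecke_tau).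
exists (g \o (t \o tau)); first by rewrite /= tN.
have := @crossed_moebius (Some (s - lam)%:C) (Some (r - lam)%:C) _ _ Ht' zE
  erefl erefl (ne _ _ _) zl.
by rewrite /= -!realCD !subrK tx ty; apply; lra.
Qed.

Lemma crossed_vertex x y v g : g None = v -> crossed q x y g ->
  sg_vertex (qchain q x y) v.
Proof.
(* The vertex of index 0 of [E] is infinity. *)
move=> gv Cg; exists g => //; exists (Ordinal (ltnW (ltnW hq))).
by rewrite /E_vertex /= -gv.
Qed.
End Hecke.

End Moebius.

Theorem theorem9 (R : realType) (q : nat) (hq : (3 <= q)%N)
  (x y : option (complex R))
  (hx : farey_vertex q x) (hy : farey_vertex q y)
  (hxy : x <> y) (hnadj : ~ farey_adj q x y)
  (p : seq (option (complex R))) (hp : geodesic_path q x y p)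
  (v : option (complex R)) (hv : v \in x :: p) :
  sg_vertex (qchain q x y) v.
Proof.
have vv : farey_vertex q v by case: hp => pp _ _; exact: farey_path_vertex hx pp hv.
(* At the two ends of the path no separating edge is sought; there non-adjacency gives the face. *)
have [->|vx] := EM (v = x).
  have [g gv Cg] := crossed_at_end hq hx hy hxy hnadj.
  exact: crossed_vertex gv Cg.
have [->|vy] := EM (v = y).
  have [||g gv /crossed_sym Cg] := crossed_at_end hq hy hx.
  - by move=> e; apply: hxy.
  - by move=> [g Hg e]; apply: hnadj; exists g; rewrite // setUC.
  exact: crossed_vertex gv Cg.
have [g Hg gv] := vv; have [g' Hg' [gK g'K]] := Hecke_inv Hg.
have real u : farey_vertex q u -> v <> u -> exists c : R, u = g (Some c%:C).
  move=> /farey_vertex_bd bu vu; have [|c uE] := bd_real (Hecke_bd Hg' bu).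
    by move=> /(congr1 g); rewrite g'K => uN; apply: vu; rewrite uN.
  by exists c; rewrite -uE g'K.
have [c xE] := real x hx vx; have [d yE] := real y hy vy.
suff [[h hN Ch]|[a [b [ab v0 xv yv]]]] :
    (exists2 h, h None = v & crossed q x y h) \/
    (exists a b, [/\ farey_adj q a b, ccw a b v != 0,
       ccw a b x * ccw a b v <= 0 & ccw a b y * ccw a b v <= 0]).
- exact: crossed_vertex hN Ch.
- by case: (geodesic_not_separated hq hx hp hv ab v0 xv); rewrite mulrC.
(* The claim is symmetric in [x] and [y], so the order of [c] and [d] is immaterial. *)
case: (ltgtP c d) => [cd|dc|e].
- exact: crossed_or_separated Hg gv xE yE cd.
- case: (crossed_or_separated hq Hg gv yE xE dc) =>
    [[h hN /crossed_sym Ch]|[a [b [? ? ? ?]]]].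
    by left; exists h.
  by right; exists a, b.
- by case: hxy; rewrite xE yE e.
Qed.
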